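(* For every positive integer $d$, the $d+1$ polynomials $P_{2d-1},P_{2d},P_{2d-1,1},P_{2d-1,2},\dots,P_{2d-1,d-1}$ are affinely independent.
   Context: $G_n$ is the ladder graph with vertices $(j,0),(j,1)$, $0\le j\le n$, horizontal edges $(j,a)(j+1,a)$ and vertical edges $(j,0)(j,1)$, embedded in the plane; its elementary regions are $n$ unit squares, the $i$-th with corners in columns $i-1,i$. For $1\le i\le n$, $G_{n,i}$ is obtained from $G_n$ by adding a unit square below the $i$-th square (new vertices $(i-1,-1),(i,-1)$ and edges $(i-1,0)(i-1,-1)$, $(i-1,-1)(i,-1)$, $(i,-1)(i,0)$). For such a graph $G$, a tiling is a partition of the vertex set into edges of $G$ and vertex sets of unit squares; the tilings form a cubical complex $\mathcal{C}(G)$ in which a tiling using exactly $k$ squares is a $k$-dimensional face. With $f_k$ the number of $k$-dimensional faces, $F_G(x)=\sum_kf_kx^k$, and $P_n(x)=F_{G_n}(x-1)$, $P_{n,i}(x)=F_{G_{n,i}}(x-1)$. These polynomials lie in the space of real polynomials of degree at most $d$. *)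

(* Defs.v *)
From HB Require Import structures.
From mathcomp Require Import all_boot all_order all_algebra.
From mathcomp Require Import reals.

Set Implicit Arguments.
Unset Strict Implicit.
Unset Printing Implicit Defensive.

Import Order.TTheory GRing.Theory Num.Theory.

Local Open Scope ring_scope.

(* A finite plane graph with vertices in an ambient finite type [T]; edges and
   unit squares (its elementary regions) are given by their vertex sets. *)
Record square_graph (T : finType) := SquareGraph {
  verts : {set T};
  edges : {set {set T}};
  squares : {set {set T}}
}.

Definition tiling (T : finType) (G : square_graph T) (P : {set {set T}}) : bool :=
  partition P (verts G) && (P \subset edges G :|: squares G).

(* f_k: the k-dimensional faces of the cubical complex C(G) are the tilings
   using exactly k squares. *)
Definition face_number (T : finType) (G : square_graph T) (k : nat) : nat :=
  #|[set P : {set {set T}} | tiling G P & #|P :&: squares G| == k]|.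

(* F_G; no tiling uses more than #|squares G| squares. *)
Definition F_poly (R : realType) (T : finType) (G : square_graph T) : {poly R} :=
  \poly_(k < #|squares G|.+1) (face_number G k)%:R.

Definition P_poly (R : realType) (T : finType) (G : square_graph T) : {poly R} :=
  F_poly R G \Po ('X - 1%:P).

(* The lattice points (j, y) with 0 <= j <= n and -1 <= y <= 1; the second
   component stores y + 1. *)
Definition grid (n : nat) : finType := ('I_n.+1 * 'I_3)%type.

Definition rowm1 : 'I_3 := inord 0.
Definition row0 : 'I_3 := inord 1.
Definition row1 : 'I_3 := inord 2.

(* [inord j] is the column j whenever j <= n. *)
Definition pt (n j : nat) (y : 'I_3) : grid n := (inord j, y).

Definition ladder (n : nat) : square_graph (grid n) := {|
  verts := [set pt n j row0 | j : 'I_n.+1] :|: [set pt n j row1 | j : 'I_n.+1];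
  edges :=
    [set [set pt n j row0; pt n j.+1 row0] | j : 'I_n] :|:
    [set [set pt n j row1; pt n j.+1 row1] | j : 'I_n] :|:
    [set [set pt n j row0; pt n j row1] | j : 'I_n.+1];
  squares :=
    [set [set pt n j row0; pt n j.+1 row0; pt n j row1; pt n j.+1 row1]
       | j : 'I_n]
|}.

(* G_{n,i}, meaningful for 1 <= i <= n. *)
Definition ladder_plus (n i : nat) : square_graph (grid n) := {|
  verts := verts (ladder n) :|: [set pt n i.-1 rowm1; pt n i rowm1];
  edges := edges (ladder n) :|:
    [set [set pt n i.-1 row0; pt n i.-1 rowm1];
         [set pt n i.-1 rowm1; pt n i rowm1];
         [set pt n i rowm1; pt n i row0]];
  squares := squares (ladder n) :|:
    [set [set pt n i.-1 row0; pt n i row0; pt n i.-1 rowm1; pt n i rowm1]]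
|}.

Definition P_ladder (R : realType) (n : nat) : {poly R} := P_poly R (ladder n).

Definition P_ladder_plus (R : realType) (n i : nat) : {poly R} :=
  P_poly R (ladder_plus n i).

(* Affine independence of the family s`_0, s`_1, ... (in particular its members
   are pairwise distinct). *)
Definition affinely_independent (R : realType) (V : lmodType R) (s : seq V) : Prop :=
  forall c : 'I_(size s) -> R,
    \sum_i c i = 0 -> \sum_i c i *: s`_i = 0 -> forall i, c i = 0.

(* Main.v *)
Require Import Defs.
From HB Require Import structures.
From mathcomp Require Import all_boot all_order all_algebra.
From mathcomp Require Import reals.
From mathcomp Require Import zify ring.

Set Implicit Arguments.
Unset Strict Implicit.
Unset Printing Implicit Defensive.

Import Order.TTheory GRing.Theory Num.Theory.

Local Open Scope ring_scope.

(** Removing the tile that covers a fixed vertex gives a recurrence for the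
tiling generating function. On the ladder with m columns it reads
p_(m+2) = p_(m+1) + X p_m after the shift of the variable, so P_n = p_(n+1).
In G_(n,i), either the two lower vertices form a tile of their own, or the
lower square (or its two vertical sides) cuts a notch out of the ladder; then
the two top vertices above the notch must be matched together, since otherwise
a piece with an odd number of vertices is left over. Hence
P_(n,i) = p_(n+1) + X p_(i-1) p_(n-i).

With N = d - 1, an affine relation becomes, after division by X, a linear
relation between p_(2N+1) and the products p_j p_(2N-j), j < N. Both expand in
the family X^k p_(2N-2k), k <= N:
  p_(2N+1) = \sum_(k <= N) X^k p_(2N-2k),
  p_j p_(2N-j) = \sum_(k <= j) (-X)^k p_(2N-2k)  (d'Ocagne's identity),
and this family is independent because X^k p_(2N-2k) has lowest term X^k. *)

(** * Weighted tiling sums and the removal of one tile *)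

Section TilingSum.

Variables (A : comNzRingType) (x : A) (T : finType).
Implicit Types (G : square_graph T) (V B : {set T}) (P : {set {set T}}).

Definition tiles G : {set {set T}} := edges G :|: squares G.

(** The vertex set [V] is free to differ from [verts G], so that removing a tile changes [V] while
    [G] stays fixed. *)
Definition tiling_sum G V : A :=
  \sum_(P | partition P V && (P \subset tiles G)) x ^+ #|P :&: squares G|.

Definition tile_weight G B : A := if B \in squares G then x else 1.

Lemma tiling_sum0 G : tiling_sum G set0 = 1.
Proof.
rewrite /tiling_sum (big_pred1 set0) => [|P /=]; first by rewrite set0I cards0.
by rewrite partition_set0; case: eqVneq => [->|//]; rewrite sub0set.
Qed.

(** Tilings are sorted by the tile [B] covering [v]; deleting [B] is a bijection onto the tilings of
    what remains, and it costs a factor [x] exactly when [B] is a square. *)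
Lemma tiling_sum_peel G V v : v \in V ->
  tiling_sum G V = \sum_(B | [&& B \in tiles G, v \in B & B \subset V])
                      tile_weight G B * tiling_sum G (V :\: B).
Proof.
move=> vV; rewrite /tiling_sum (partition_big (fun P => pblock P v)
  (fun B => [&& B \in tiles G, v \in B & B \subset V])) /=; last first.
  move=> P /andP[PV /subsetP sPG].
  have vP : v \in cover P by rewrite (cover_partition PV).
  by rewrite sPG ?pblock_mem // mem_pblock vP (partitionS PV) ?pblock_mem.
apply: eq_bigr => B /and3P[BG vB BV].
rewrite (reindex_onto (fun P => B |: P) (fun P => P :\ B)) /=; last first.
  move=> P /andP[/andP[PV _] /eqP <-]; rewrite setD1K // pblock_mem //.
  by rewrite (cover_partition PV).
rewrite big_distrr /=; apply: eq_big => [P|P].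
  apply/idP/idP.
    case/andP=> /andP[/andP[BPV BPG] _] /eqP <-.
    rewrite partitionD1 ?setU11 //=; apply: subset_trans BPG.
    exact: subD1set.
  case/andP=> PVB PG.
  (* A block of [P] lies in [V :\: B] and so misses [v]; hence adding [B] and then removing it gives
     [P] back. *)
  have BP : B \notin P.
    apply/negP => /(partitionS PVB)/subsetP/(_ _ vB).
    by rewrite inE vB.
  have BPV : partition (B |: P) V.
    rewrite -(setID V B) (setIidPr BV); apply: partitionU1 => //.
      by apply/set0Pn; exists v.
    by rewrite disjoint_sym disjoints_subset subsetDr.
  rewrite BPV setU1K // eqxx subUset sub1set BG PG andbT /=.
  by apply/eqP; apply: def_pblock; rewrite ?setU11 ?(partition_trivIset BPV).
case/andP=> _ /eqP BPP.
have BP : B \notin P by rewrite -BPP !inE eqxx.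
rewrite /tile_weight; case: ifP => BS.
  rewrite -exprS setIUl (setIidPl _) ?sub1set // cardsU1 inE (negPf BP) /=.
  by rewrite add1n.
rewrite mul1r setIUl; suff -> : [set B] :&: squares G = set0 by rewrite set0U.
by apply/setP => C; rewrite !inE; case: eqP => // ->.
Qed.

(** Only tiles contained in [V] can occur, so graphs that agree inside [V] have equal sums. *)
Lemma eq_tiling_sum G H V :
    {in powerset V, forall B, (B \in edges G) = (B \in edges H)} ->
    {in powerset V, forall B, (B \in squares G) = (B \in squares H)} ->
  tiling_sum G V = tiling_sum H V.
Proof.
move=> eqE eqS; apply: eq_big => [P|P /andP[PV _]].
  apply: andb_id2l => PV; apply/subsetP/subsetP => sP B BP; move: (sP B BP).
    by rewrite !inE eqE ?eqS // inE (partitionS PV).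
  by rewrite !inE eqE ?eqS // inE (partitionS PV).
congr (x ^+ #|pred_of_set _|); apply/setP => B; rewrite !inE.
by apply: andb_id2l => BP; rewrite eqS // inE (partitionS PV).
Qed.

End TilingSum.

(** Composition with ['X - 1] is a ring morphism, so it replaces the weight ['X] of each square by
    ['X - 1]. *)
Lemma P_polyE (R : realType) (T : finType) (G : square_graph T) :
  P_poly R G = tiling_sum ('X - 1%:P : {poly R}) G (verts G).
Proof.
rewrite /P_poly; have -> : F_poly R G = tiling_sum 'X G (verts G).
  apply/polyP => k; rewrite coef_poly coef_sum.
  under eq_bigr do rewrite coefXn eq_sym mulrb.
  rewrite -big_mkcondr /= sumr_const /face_number.
  case: ltnP => [_|k_gt]; first by congr (_ *+ _); apply: eq_card => P; rewrite !inE.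
  (* Beyond the truncation degree no tiling is counted: its squares are among those of [G]. *)
  rewrite eq_card0 // => P; rewrite inE /=; apply/negP => /andP[_ /eqP Pk].
  by move: k_gt; rewrite -Pk ltnNge subset_leq_card // subsetIr.
by rewrite raddf_sum /=; apply: eq_bigr => P _; rewrite rmorphXn /= comp_polyX.
Qed.

(** * Fibonacci-type polynomials and their identities *)

(** At [q = 1] these are the Fibonacci numbers started at 1, 1. The index counts columns, with the
    empty ladder at 0. *)
Fixpoint fib_poly (A : comNzRingType) (q : A) (m : nat) : A :=
  if m is m1.+1 then
    if m1 is m2.+1 then fib_poly q m1 + q * fib_poly q m2 else 1
  else 1.
Arguments fib_poly : simpl never.

Section FibPoly.

Variables (A : comNzRingType) (q : A).
Local Notation p := (fib_poly q).

Lemma fib_polySS m : p m.+2 = p m.+1 + q * p m.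
Proof. by []. Qed.

(** The recurrence is unrolled at odd indices only, each step releasing one even-index term. *)
Lemma fib_poly_odd_expand N : p (N.*2.+1) = \sum_(k < N.+1) q ^+ k * p (N - k).*2.
Proof.
elim: N => [|N IH]; first by rewrite big_ord1 mul1r.
rewrite doubleS fib_polySS IH [RHS]big_ord_recl mul1r subn0; congr (_ + _).
by rewrite mulr_sumr; apply: eq_bigr => k _; rewrite mulrA -exprS subSS.
Qed.

(** The difference of the two products is multiplied by [- q] each time [j] grows by one. *)
Lemma fib_poly_docagne j m :
  p j.+1 * p (j.+1 + m) = p j * p (j + m).+2 + (- q) ^+ j.+1 * p m.
Proof.
elim: j => [|j IH]; first by rewrite add0n add1n fib_polySS expr1 !mul1r mulNr addrK.
move: IH; rewrite !addSn (fib_polySS j) (fib_polySS (j + m).+1).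
rewrite [(- q) ^+ j.+2]exprSr => IH.
move: (p j) (p j.+1) (p (j + m).+1) (p (j + m).+2) IH => a b c d IH.
have -> : (b + q * a) * d = b * d + q * (a * d) by ring.
(* The induction hypothesis eliminates the only product on which the two sides differ. *)
rewrite (_ : a * d = b * c - (- q) ^+ j.+1 * p m); last by rewrite IH addrK.
by move: ((- q) ^+ j.+1) (p m) => e f; ring.
Qed.

(** Consecutive products with index sum [N.*2] differ by one term of d'Ocagne's identity, taken at
    [m = (N - j.+1).*2]; the sum telescopes. *)
Lemma fib_polyM_expand N j : (j <= N)%N ->
  p j * p (N.*2 - j) = \sum_(k < j.+1) (- q) ^+ k * p (N - k).*2.
Proof.
elim: j => [|j IH] jN; first by rewrite big_ord1 !mul1r !subn0.
have -> : (N.*2 - j.+1 = j.+1 + (N - j.+1).*2)%N by lia.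
have e : ((j + (N - j.+1).*2).+2 = N.*2 - j)%N by lia.
by rewrite fib_poly_docagne big_ord_recr -IH 1?ltnW // e.
Qed.

End FibPoly.

(** * Linear independence of the products of these polynomials *)

Section FibIndependent.

Variable (R : idomainType).
Local Notation p := (fib_poly ('X : {poly R})).

Lemma fib_poly_coef0 m : (p m)`_0 = 1.
Proof.
suff: ((p m)`_0 = 1) /\ ((p m.+1)`_0 = 1) by case.
elim: m => [|m [IH0 IH1]]; first by rewrite coef1.
by split=> //; rewrite fib_polySS coefD IH1 coefXM addr0.
Qed.

(** The constant coefficient of the relation is [a 0]; once it vanishes, division by ['X] leaves a
    shorter relation of the same kind. *)
Lemma echelon_free n (a : nat -> R) (g : nat -> {poly R}) :
    (forall k, (g k)`_0 = 1) ->
    \sum_(k < n) a k *: ('X^k * g k) = 0 ->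
  forall k, (k < n)%N -> a k = 0.
Proof.
elim: n a g => [|n IH] a g g0 //; rewrite big_ord_recl mul1r => sum0.
have a0 : a 0%N = 0.
  move/(congr1 (fun r : {poly R} => r`_0)): (sum0).
  rewrite coefD coefZ g0 coef_sum big1 ?coef0 ?addr0 ?mulr1 // => i _.
  by rewrite coefZ coefXnM mulr0.
case=> [|k] // kn; apply: (IH (fun k => a k.+1) (fun k => g k.+1)) => //.
apply: (mulfI (negbT (polyX_eq0 R))); rewrite mulr0 -[RHS]sum0 a0.
rewrite scale0r add0r mulr_sumr.
by apply: eq_bigr => i _; rewrite -scalerAr mulrA -exprS.
Qed.

(** In the family ['X^k * p (N - k).*2] the relation has coefficients [b + (-1) ^+ k * s k], with
    [s k] the tail sum of [e] from [k] on; all of them vanish. *)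
Lemma fib_poly_products_free N (b : R) (e : nat -> R) :
    b *: p N.*2.+1 + \sum_(j < N) e j *: (p j * p (N.*2 - j)) = 0 ->
  b = 0 /\ forall j, (j < N)%N -> e j = 0.
Proof.
pose s k := \sum_(j < N | (k <= j)%N) e j.
move=> sum0; have z k : (k < N.+1)%N -> b + (-1) ^+ k * s k = 0.
  move: k; apply: (@echelon_free N.+1 (fun k => b + (-1) ^+ k * s k)
    (fun k => p (N - k).*2)) => [k|].
    exact: fib_poly_coef0.
  rewrite -[RHS]sum0 fib_poly_odd_expand scaler_sumr.
  under eq_bigr do rewrite scalerDl.
  rewrite big_split; congr (_ + _) => /=.
  (* The inner sums are extended to the common range [k < N.+1], with a condition [k <= j], so that
     the two summations can be exchanged. *)
  under [RHS]eq_bigr => j _.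
    rewrite fib_polyM_expand ?(ltnW (ltn_ord j)) // scaler_sumr.
    rewrite (big_ord_widen N.+1 (fun k => e j *: ((- 'X) ^+ k * p (N - k).*2)))
      ?ltnS ?(ltnW (ltn_ord j)) // big_mkcond.
    over.
  rewrite exchange_big /=; apply: eq_bigr => k _.
  rewrite -big_mkcond /= /s -scalerA scaler_suml scaler_sumr.
  apply: eq_big => [j|j _]; first by rewrite ltnS.
  rewrite scalerA mulrC -scalerA (exprNn 'X) -mulrA -!(signr_odd _ k).
  by case: (odd k); rewrite ?scale1r ?mul1r ?scaleN1r ?mulN1r.
(* The tail at [N] is empty, so the last coefficient is [b] alone. *)
have sN : s N = 0 by rewrite /s big1 // => j; rewrite leqNgt ltn_ord.
have b0 : b = 0 by have := z N (ltnSn N); rewrite sN mulr0 addr0.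
have s0 k : (k <= N)%N -> s k = 0.
  move=> kN; have /eqP := z k kN; rewrite b0 add0r mulf_eq0 signr_eq0.
  by move/eqP.
(* Each [e j] is the difference of the consecutive tails [s j] and [s j.+1]. *)
split=> // j jN; have := s0 j (ltnW jN); rewrite /s (bigD1 (Ordinal jN)) //=.
rewrite (eq_bigl (fun i : 'I_N => (j < i)%N)) => [|i]; last first.
  by rewrite -val_eqE /=; lia.
by rewrite -/(s j.+1) s0 // addr0.
Qed.

End FibIndependent.

(** * Regions of the grid and graphs whose tiles are rectangles *)

(** Vertex sets are described by predicates on natural coordinates, so that questions about them
    become linear arithmetic. *)
Definition region n (f : nat -> nat -> bool) : {set grid n} :=
  [set v : grid n | f v.1 v.2].

(* A tuple (j, w, y, h) encodes the lattice points of the columns j, ..., j + w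
   and the (shifted) rows y, ..., y + h; all tiles are of this form. *)
Definition in_rect (t : nat * nat * nat * nat) (a b : nat) : bool :=
  let: (j, w, y, h) := t in ((j <= a <= j + w) && (y <= b <= y + h))%N.

Definition rect n t : {set grid n} := region n (in_rect t).

Lemma mem_region n f a b : (a <= n)%N -> (b <= 2)%N ->
  (pt n a (inord b) \in region n f) = f a b.
Proof. by move=> an b2; rewrite inE /= !inordK. Qed.

Lemma eq_region n f g :
    (forall a b, (a <= n)%N -> (b <= 2)%N -> f a b = g a b) ->
  region n f = region n g.
Proof.
by move=> fg; apply/setP => -[a b]; rewrite !inE fg //= -ltnS ltn_ord.
Qed.

Lemma region_subP n (f g : nat -> nat -> bool) :
  reflect (forall a b, (a <= n)%N -> (b <= 2)%N -> f a b -> g a b)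
          (region n f \subset region n g).
Proof.
apply: (iffP subsetP) => [fg a b an b2|fg [a b]].
  by have := fg (pt n a (inord b)); rewrite !mem_region.
by rewrite !inE /=; apply: fg; rewrite -ltnS ltn_ord.
Qed.

Lemma regionD n f g :
  region n f :\: region n g = region n (fun a b => f a b && ~~ g a b).
Proof. by apply/setP => v; rewrite !inE andbC. Qed.

Definition in_strip n (t : nat * nat * nat * nat) : bool :=
  let: (j, w, y, h) := t in ((j + w <= n) && (y + h <= 2))%N.

(** Testing two opposite corners of each rectangle for membership in the other recovers the
    parameters. A rectangle leaving the strip would be cut off, hence the restriction. *)
Lemma rect_inj n : {in in_strip n &, injective (rect n)}.
Proof.
move=> [[[j w] y] h] [[[j' w'] y'] h']; rewrite !unfold_in => /= s s' E.
have e a b : (a <= n)%N -> (b <= 2)%N ->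
    in_rect (j, w, y, h) a b = in_rect (j', w', y', h') a b.
  by move=> an b2; rewrite -(mem_region _ an b2) -/(rect n _) E mem_region.
have := e j y; have := e (j + w)%N (y + h)%N.
have := e j' y'; have := e (j' + w')%N (y' + h')%N.
rewrite /= => e1 e2 e3 e4.
have [? ? ? ?] : [/\ j = j', w = w', y = y' & h = h'] by split; lia.
by congr (_, _, _, _).
Qed.

(** The predicate [ok] selects the parameters of the tiles; squares are those extended in both
    directions. *)
Definition rect_graph n (G : square_graph (grid n))
    (ok : nat * nat * nat * nat -> bool) : Prop :=
  [/\ forall t, ok t -> in_strip n t,
      forall B, B \in tiles G <-> exists2 t, ok t & B = rect n t &
      forall j w y h, ok (j, w, y, h) ->
        (rect n (j, w, y, h) \in squares G) = (0 < w)%N && (0 < h)%N].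

Section RectGraph.

Variables (A : comNzRingType) (x : A) (n : nat).
Variables (G : square_graph (grid n)) (ok : nat * nat * nat * nat -> bool).
Hypothesis Gok : rect_graph G ok.

Definition region_sum f : A := tiling_sum x G (region n f).

Definition rect_weight (t : nat * nat * nat * nat) : A :=
  let: (_, w, _, h) := t in if (0 < w)%N && (0 < h)%N then x else 1.

(** This form of the recurrence takes an explicit list [ts] of the tiles that cover [(c, r)] inside
    the region; checking the list is arithmetic on parameters. *)
Lemma region_sum_peel (f : nat -> nat -> bool) c r ts :
    (c <= n)%N -> (r <= 2)%N -> f c r -> uniq ts ->
    (forall t, t \in ts <-> [/\ ok t, in_rect t c r &
                              forall a b, in_rect t a b -> f a b]) ->
  region_sum f = \sum_(t <- ts)
    rect_weight t * region_sum (fun a b => f a b && ~~ in_rect t a b).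
Proof.
case: Gok => okn okT okS cn r2 fcr uts tsP.
rewrite /region_sum (@tiling_sum_peel _ _ _ _ _ (pt n c (inord r))) ?mem_region //.
have uR : uniq [seq rect n t | t <- ts].
  rewrite map_inj_in_uniq // => t u /tsP[/okn tn _ _] /tsP[/okn un _ _].
  exact: rect_inj.
rewrite (eq_bigl (mem [seq rect n t | t <- ts])) => [|B /=].
  rewrite -big_uniq // big_map; apply: eq_big_seq => -[[[j w] y] h] /tsP[okt _ _].
  by rewrite /tile_weight okS // regionD.
apply/and3P/mapP => [[/okT[t okt ->]]|[t /tsP[okt tcr tf] ->]].
  rewrite mem_region // => tcr /region_subP tf; exists t => //.
  apply/tsP; split=> // a b tab; apply: tf => //.
    by case: t okt tab {tcr} => [[[j w] y] h] /okn /=; lia.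
  by case: t okt tab {tcr} => [[[j w] y] h] /okn /=; lia.
split; [by apply/okT; exists t|by rewrite mem_region|].
by apply/region_subP => a b _ _; apply: tf.
Qed.

Lemma eq_region_sum f g :
    (forall a b, (a <= n)%N -> (b <= 2)%N -> f a b = g a b) ->
  region_sum f = region_sum g.
Proof. by move=> fg; rewrite /region_sum (eq_region fg). Qed.

Lemma region_sum_empty (f : nat -> nat -> bool) :
  (forall a b, (a <= n)%N -> (b <= 2)%N -> ~~ f a b) -> region_sum f = 1.
Proof.
move=> f0; rewrite /region_sum -(tiling_sum0 x G); congr tiling_sum.
apply/setP => -[a b]; rewrite !inE; apply/negbTE/f0; rewrite -ltnS ltn_ord //.
Qed.

End RectGraph.

(** * The tiles of the two kinds of graphs, as rectangles *)

Definition ladder_ok n (t : nat * nat * nat * nat) : bool :=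
  let: (j, w, y, h) := t in
  [&& j + w <= n, w <= 1, h <= 1, 0 < y, y + h <= 2 & 0 < w + h]%N.

(** The four extra tiles are the left side, the bottom edge, the right side and the added square
    itself. *)
Definition ladder_plus_ok n i t : bool :=
  ladder_ok n t || (t \in [:: (i.-1, 0, 0, 1); (i.-1, 1, 0, 0);
                              (i, 0, 0, 1); (i.-1, 1, 0, 1)]%N).

Lemma pair_rect n j w y h : in_strip n (j, w, y, h) -> (w + h = 1)%N ->
  [set pt n j (inord y); pt n (j + w) (inord (y + h))] = rect n (j, w, y, h).
Proof.
move=> /= s wh; apply/setP => -[a b]; rewrite !inE !xpair_eqE -!val_eqE /=.
rewrite !inordK; lia.
Qed.

Lemma quad_rect n j y : in_strip n (j, 1, y, 1)%N ->
  [set pt n j (inord y.+1); pt n j.+1 (inord y.+1);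
       pt n j (inord y); pt n j.+1 (inord y)] = rect n (j, 1, y, 1)%N.
Proof.
move=> /= s; apply/setP => -[a b]; rewrite !inE !xpair_eqE -!val_eqE /=.
rewrite !inordK; lia.
Qed.

Lemma mem_ladder_edges n B :
  B \in edges (ladder n) <->
  exists j w y h, [/\ ladder_ok n (j, w, y, h), (w + h = 1)%N
                    & B = rect n (j, w, y, h)].
Proof.
rewrite !inE; split=> [/orP[/orP[]|]/imsetP[[j jn] _ ->] /=|].
- exists j, 1%N, 1%N, 0%N; split; rewrite ?/ladder_ok //; first by lia.
  by rewrite -pair_rect /= ?addn1 ?addn0 //; lia.
- exists j, 1%N, 2%N, 0%N; split; rewrite ?/ladder_ok //; first by lia.
  by rewrite -pair_rect /= ?addn1 ?addn0 //; lia.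
- exists j, 0%N, 1%N, 1%N; split; rewrite ?/ladder_ok //; first by lia.
  by rewrite -pair_rect /= ?addn1 ?addn0 //; lia.
case=> j [w [y [h [/= ok wh ->]]]]; rewrite -pair_rect //=; last by lia.
case: w wh ok => [|[|//]] wh ok.
  have [-> ->] : y = 1%N /\ h = 1%N by lia.
  have jn : (j < n.+1)%N by lia.
  by apply/orP; right; apply/imsetP; exists (Ordinal jn); rewrite ?addn0.
have -> : h = 0%N by lia.
have jn : (j < n)%N by lia.
have [->|->] : y = 1%N \/ y = 2%N by lia.
  by apply/orP; left; apply/orP; left; apply/imsetP; exists (Ordinal jn);
     rewrite ?addn1 ?addn0.
by apply/orP; left; apply/orP; right; apply/imsetP; exists (Ordinal jn);
   rewrite ?addn1 ?addn0.
Qed.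

Lemma mem_ladder_squares n B :
  B \in squares (ladder n) <-> exists2 j, (j < n)%N & B = rect n (j, 1, 1, 1)%N.
Proof.
have e j : (j < n)%N ->
    [set pt n j Defs.row0; pt n j.+1 Defs.row0; pt n j Defs.row1; pt n j.+1 Defs.row1] =
    rect n (j, 1, 1, 1)%N.
  move=> jn; rewrite -quad_rect /=; last by lia.
  by apply/setP => v; rewrite !inE -/Defs.row0 -/Defs.row1; do !case: (_ == _).
split=> [/imsetP[[j jn] _ ->]|[j jn ->]]; first by exists j => //=; exact: e.
by apply/imsetP; exists (Ordinal jn) => //=; rewrite e.
Qed.

Lemma ladder_rect_graph n : rect_graph (ladder n) (ladder_ok n).
Proof.
split=> [[[[j w] y] h] /=|B|j w y h ok]; first by lia.
  rewrite /tiles inE; split.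
    case/orP=> [/mem_ladder_edges[j [w [y [h [ok _ ->]]]]]|].
      by exists (j, w, y, h).
    by case/mem_ladder_squares=> j jn ->; exists (j, 1, 1, 1)%N => //=; lia.
  case=> -[[[j w] y] h] ok ->; apply/orP.
  have [wh|wh] := eqVneq (w + h)%N 1%N.
    by left; apply/mem_ladder_edges; exists j, w, y, h.
  right; apply/mem_ladder_squares; exists j; first by move: ok => /=; lia.
  by congr rect; congr (_, _, _, _); move: ok => /=; lia.
apply/idP/idP.
  case/mem_ladder_squares=> k kn E.
  have s : in_strip n (j, w, y, h) by move: ok => /=; lia.
  have s' : in_strip n (k, 1, 1, 1)%N by rewrite /=; lia.
  by case: (rect_inj s s' E) => _ -> _ ->.
move=> wh; apply/mem_ladder_squares; exists j; first by move: ok => /=; lia.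
by congr rect; congr (_, _, _, _); move: ok => /=; lia.
Qed.

Lemma ladder_plus_rect_graph n i : (0 < i <= n)%N ->
  rect_graph (ladder_plus n i) (ladder_plus_ok n i).
Proof.
move=> i_n; have [okn okT okS] := ladder_rect_graph n.
have okn' t : ladder_plus_ok n i t -> in_strip n t.
  case/orP=> [/okn //|]; rewrite !inE => /or4P[] /eqP -> /=; lia.
have Bsq B : B \in squares (ladder_plus n i) =
    (B \in squares (ladder n)) || (B == rect n (i.-1, 1, 0, 1)%N).
  rewrite !inE -quad_rect /= ?prednK //; lia.
have Bed B : B \in edges (ladder_plus n i) =
    [|| B \in edges (ladder n), B == rect n (i.-1, 0, 0, 1)%N,
        B == rect n (i.-1, 1, 0, 0)%N | B == rect n (i, 0, 0, 1)%N].
  have e j : (j <= n)%N ->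
      [set pt n j Defs.row0; pt n j rowm1] = rect n (j, 0, 0, 1)%N.
    by move=> jn; rewrite setUC -pair_rect ?addn0 //=; lia.
  have e' : [set pt n i.-1 rowm1; pt n i rowm1] = rect n (i.-1, 1, 0, 0)%N.
    by rewrite -pair_rect ?addn1 ?prednK //=; lia.
  have e3 := setUC [set pt n i rowm1].
  rewrite [in LHS]/ladder_plus /= e' e3 !e; try by lia.
  by rewrite in_setU; congr (_ || _); rewrite !inE orbA.
split=> // [B|j w y h ok].
  have -> : (B \in tiles (ladder_plus n i)) =
    [|| B \in tiles (ladder n), B == rect n (i.-1, 0, 0, 1)%N,
        B == rect n (i.-1, 1, 0, 0)%N, B == rect n (i, 0, 0, 1)%N |
        B == rect n (i.-1, 1, 0, 1)%N].
    rewrite /tiles inE Bsq Bed [in RHS]inE.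
    by do !case: (_ \in _); rewrite ?orbT //= -?orbA.
  split.
    case/orP=> [/okT[t ok ->]|]; first by exists t; rewrite // /ladder_plus_ok ok.
    case/or4P=> /eqP ->; [exists (i.-1, 0, 0, 1)%N | exists (i.-1, 1, 0, 0)%N
      | exists (i, 0, 0, 1)%N | exists (i.-1, 1, 0, 1)%N] => //;
    by rewrite /ladder_plus_ok !inE eqxx ?orbT.
  case=> t /orP[ok|tin] ->; first by apply/orP; left; apply/okT; exists t.
  by move: tin; rewrite !inE => /or4P[]/eqP ->; rewrite eqxx ?orbT.
rewrite Bsq; have [E|ne] := eqVneq.
  have s : in_strip n (i.-1, 1, 0, 1)%N by rewrite /=; lia.
  by case: (rect_inj (okn' _ ok) s E) => _ -> _ ->; rewrite orbT.
rewrite orbF; case/orP: (ok) => [|]; first exact: okS.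
(* The extra tiles start in the lowest row, while squares of the ladder start in row 1. *)
move=> okp; have y0 : y = 0%N by move: okp; rewrite !inE !xpair_eqE; lia.
have -> : (0 < w)%N && (0 < h)%N = false.
  by apply: contraNF ne => wh; apply/eqP; congr rect; congr (_, _, _, _);
     move: okp; rewrite !inE !xpair_eqE; lia.
apply/negbTE/negP => /mem_ladder_squares[k kn E].
have s : in_strip n (k, 1, 1, 1)%N by rewrite /=; lia.
by case: (rect_inj (okn' _ ok) s E) => _ _; rewrite y0.
Qed.

(** * Tiling sums of regions of the ladder *)

Section LadderSum.

Variables (A : comNzRingType) (x : A) (n : nat).
Local Notation W := (region_sum x (ladder n)).

Definition columns (S : pred nat) (a b : nat) : bool := S a && (0 < b)%N.

(** Both neighbouring columns are absent, so only the vertical edge covers column [c]. *)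
Lemma ladder_sum_peel1 (S : pred nat) c : (c <= n)%N -> S c -> ~~ S c.+1 ->
    (forall j, j.+1 = c -> ~~ S j) ->
  W (columns S) = W (columns (fun j => S j && (j != c))).
Proof.
move=> cn Sc Sc1 Sc0.
rewrite (@region_sum_peel _ x _ _ _ (ladder_rect_graph n) _ c 2 [:: (c, 0, 1, 1)%N]) //.
- rewrite big_seq1 mul1r; apply: eq_region_sum => a b _ b2; rewrite /columns /=; lia.
- by rewrite /columns Sc.
case=> [[[j w] y] h]; rewrite inE; split.
  case/eqP=> -> -> -> ->; split=> [||a b] /=; try lia.
  by move=> ab; rewrite /columns (_ : a = c) ?Sc; lia.
case=> /= ok tc sub; have Sj : S j by have /andP[] := sub j y ltac:(lia).
have Sjw : S (j + w)%N by have /andP[] := sub (j + w)%N y ltac:(lia).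
have jc : j = c.
  by have := Sc0 j; rewrite Sj; lia.
have w0 : w = 0%N.
  have [//|w1] : w = 0%N \/ w = 1%N by lia.
  by move: Sjw; rewrite jc w1 addn1 (negPf Sc1).
by rewrite !xpair_eqE; lia.
Qed.

(** The upper vertex of the end column [c.+1] lies in the vertical edge, a horizontal edge or a
    square. The last two cases both clear two columns, with weights 1 and [x]. *)
Lemma ladder_sum_peel2 (S : pred nat) c : (c.+1 <= n)%N ->
    S c -> S c.+1 -> ~~ S c.+2 ->
  W (columns S) = W (columns (fun j => S j && (j != c.+1))) +
    (1 + x) * W (columns (fun j => [&& S j, j != c & j != c.+1])).
Proof.
move=> cn Sc Sc1 Sc2.
rewrite (@region_sum_peel _ x _ _ _ (ladder_rect_graph n) _ c.+1 2
  [:: (c.+1, 0, 1, 1); (c, 1, 2, 0); (c, 1, 1, 1)]%N) //; first last.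
- case=> [[[j w] y] h]; rewrite !inE; split.
    case/or3P=> /eqP[-> -> -> ->]; split=> [||a b] /=; try lia.
    - by move=> ab; rewrite /columns (_ : a = c.+1) ?Sc1; lia.
    - move=> ab; rewrite /columns; have [->|->] : a = c \/ a = c.+1 by lia.
        by rewrite Sc; lia.
      by rewrite Sc1; lia.
    - move=> ab; rewrite /columns; have [->|->] : a = c \/ a = c.+1 by lia.
        by rewrite Sc; lia.
      by rewrite Sc1; lia.
  case=> /= ok tc sub.
  have Sjw : S (j + w)%N by have /andP[] := sub (j + w)%N y ltac:(lia).
  have jw : (j + w = c.+1)%N.
    have [//|jw] : (j + w = c.+1 \/ j + w = c.+2)%N by lia.
    by move: Sc2; rewrite -jw Sjw.
  by rewrite !xpair_eqE; lia.
- by rewrite /= !inE !xpair_eqE; lia.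
- by rewrite /columns Sc1.
rewrite !big_cons big_nil addr0 /= !mul1r mulrDl mul1r; congr (_ + (_ + _ * _)).
- by apply: eq_region_sum => a b _ b2; rewrite /columns /=; lia.
(* The upper horizontal edge forces the lower one. *)
- rewrite (@region_sum_peel _ x _ _ _ (ladder_rect_graph n) _ c.+1 1
    [:: (c, 1, 1, 0)]%N) //; first last.
  + case=> [[[j w] y] h]; rewrite !inE; split.
      case/eqP=> -> -> -> ->; split=> [||a b] /=; try lia.
      move=> ab; rewrite /columns; have [->|->] : a = c \/ a = c.+1 by lia.
        by rewrite Sc; lia.
      by rewrite Sc1; lia.
    case=> /= ok tc sub.
    have /andP[/andP[Sjw _] _] := sub (j + w)%N y ltac:(lia).
    have jw : (j + w = c.+1)%N.
      have [//|jw] : (j + w = c.+1 \/ j + w = c.+2)%N by lia.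
      by move: Sc2; rewrite -jw Sjw.
    have /andP[_ nr] := sub (j + w)%N (y + h)%N ltac:(lia).
    by rewrite !xpair_eqE; lia.
  + by rewrite /columns Sc1 /=; lia.
  rewrite big_seq1 mul1r; apply: eq_region_sum => a b _ b2; rewrite /columns /=; lia.
- by apply: eq_region_sum => a b _ b2; rewrite /columns /=; lia.
Qed.

(** A block of [m] columns, separated from [S] by an empty column on each side, is tiled
    independently of [S]. Stating it as a factor lets disjoint blocks multiply. *)
Lemma ladder_sum_block (S : pred nat) b m : (b + m <= n.+1)%N ->
    (forall j, (b <= j.+1)%N -> (j <= b + m)%N -> ~~ S j) ->
  W (columns (fun j => S j || (b <= j < b + m)%N)) =
  fib_poly (1 + x) m * W (columns S).
Proof.
elim/ltn_ind: m => -[|[|m]] IH bm S0.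
- by rewrite mul1r; apply: eq_region_sum => a c _ _; rewrite /columns; lia.
- rewrite mul1r (@ladder_sum_peel1 _ b); try lia.
  + apply: eq_region_sum => a c _ _; rewrite /columns.
    by have := S0 b; case: (eqVneq a b) => [->|]; lia.
  + by have := S0 b.+1; lia.
  + by move=> j jb; have := S0 j; lia.
rewrite (@ladder_sum_peel2 _ (b + m)); try lia; last first.
  by have := S0 (b + m).+2; lia.
rewrite fib_polySS [RHS]mulrDl -[in RHS]mulrA -!IH; try lia.
- congr (_ + _ * _); apply: eq_region_sum => a c _ _; rewrite /columns.
    by have := S0 a; lia.
  by have := S0 a; lia.
- by move=> j b1 b2; apply: S0; lia.
- by move=> j b1 b2; apply: S0; lia.
Qed.

Lemma ladder_sum_prefix m : (m <= n.+1)%N ->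
  W (columns (fun j => j < m)%N) = fib_poly (1 + x) m.
Proof.
move=> mn; have := @ladder_sum_block pred0 0 m mn (fun _ _ _ => isT).
rewrite (region_sum_empty x (ladder n) (f := columns pred0)) // mulr1 => <-.
by apply: eq_region_sum.
Qed.

(* The left part has an odd number of vertices; peeling forces horizontal edges
   alternating between the two rows down to an isolated vertex in column 0. *)
Lemma ladder_sum_odd (f : nat -> nat -> bool) a y z : (a <= n)%N ->
    (y == 1%N) && (z == 2) || (y == 2) && (z == 1%N) ->
    f a y -> ~~ f a z -> ~~ f a.+1 y ->
    (forall j, (j < a)%N -> f j y && f j z) ->
  W f = 0.
Proof.
elim: a f y z => [|a IH] f y z an yz fay faz fay1 full.
  rewrite (@region_sum_peel _ x _ _ _ (ladder_rect_graph n) _ 0 y [::]) ?big_nil //.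
    by lia.
  case=> [[[j w] u] h]; split=> // -[/= ok tc sub].
  case: h ok tc sub => [|h] ok tc sub.
    by move: fay1; rewrite sub; lia.
  by move: faz; rewrite sub; lia.
rewrite (@region_sum_peel _ x _ _ _ (ladder_rect_graph n) _ a.+1 y
  [:: (a, 1, y, 0)%N]) //; first last.
- case=> [[[j w] u] h]; rewrite inE; split.
    case/eqP=> -> -> -> ->; split=> [||b c] /=; try lia.
    move=> bc; have -> : c = y by lia.
    have [->|->] : b = a \/ b = a.+1 by lia.
      by have /andP[] := full a (ltnSn a).
    by [].
  case=> /= ok tc sub.
  have h0 : h = 0%N.
    by case: h ok tc sub => [//|h] ok tc sub; move: faz; rewrite sub; lia.
  have ja : j = a.
    have [//|ja] : j = a \/ j = a.+1 by lia.
    by move: fay1; rewrite sub; lia.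
  by rewrite !xpair_eqE; lia.
- by lia.
rewrite big_seq1 mul1r (IH _ z y) ?(ltnW an) //; try lia.
- by have /andP[_ ->] := full a (ltnSn a); rewrite /=; lia.
- by rewrite /=; lia.
- move=> j ja; have /andP[-> ->] := full j (ltnW ja); rewrite /=; lia.
Qed.

(** The upper vertex above the left end of the notch is matched to the right or to the left.
    Matching left strands an odd piece and contributes 0; matching right leaves two separate
    ladders. *)
Lemma ladder_sum_notch k : (k < n)%N ->
  W (fun a b => (0 < b)%N && ~~ ((k <= a <= k.+1) && (b == 1))%N) =
  fib_poly (1 + x) k * fib_poly (1 + x) (n - k.+1).
Proof.
move=> kn; set f := fun a b => _.
have -> : W f = W (fun a b => f a b && ~~ in_rect (k, 1, 2, 0)%N a b).
  (* The list [ts] holds the left-going edge if there is one; the condition [t.1.1.1.+1 = k]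
     excludes the truncated predecessor at [k = 0]. *)
  have gen ts : uniq ((k, 1, 2, 0)%N :: ts) ->
      (forall t, t \in ts <-> t.1.1.1.+1 = k /\ t = (k.-1, 1, 2, 0)%N) ->
      W f = \sum_(t <- (k, 1, 2, 0)%N :: ts)
        rect_weight x t * W (fun a b => f a b && ~~ in_rect t a b).
    move=> uts tsP; apply: (@region_sum_peel _ x _ _ _ (ladder_rect_graph n) _ k 2);
      rewrite /f //; try lia.
    case=> [[[j w] y] h]; rewrite inE; split.
      case/orP=> [/eqP[-> -> -> ->]|/tsP[/= jk [-> -> -> ->]]];
      split=> [||a b] /=; lia.
    case=> /= ok tc sub.
    have h0 : h = 0%N.
      by case: h ok tc sub => [//|h] ok tc sub; have := sub k 1%N ltac:(lia); lia.
    apply/orP; have [jk|jk] : j = k \/ j.+1 = k by lia.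
      by left; rewrite !xpair_eqE; lia.
    by right; apply/tsP; split=> //; congr (_, _, _, _); lia.
  have [k0|k0] := posnP k.
    rewrite (gen [::]) //; first by rewrite big_seq1 mul1r.
    by move=> t; split=> // -[]; rewrite k0.
  rewrite (gen [:: (k.-1, 1, 2, 0)%N]).
  - rewrite big_cons big_seq1 !mul1r.
    rewrite [X in _ + X](@ladder_sum_odd _ k.-1 1 2) ?addr0 //; rewrite /f /=; try lia.
  - by rewrite /= inE !xpair_eqE; lia.
  move=> t; rewrite inE; split=> [/eqP ->|[_ ->]] //=.
  by split=> //; lia.
(* What is left consists of the columns before [k] and the [n - k.+1] columns from [k.+2] on. *)
rewrite -(ladder_sum_prefix (m := k)); last by lia.
rewrite mulrC -(@ladder_sum_block _ k.+2); try lia.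
by apply: eq_region_sum => a b an b2; rewrite /f /columns /=; lia.
Qed.

End LadderSum.

(** * Vertex sets, and the tiling sum of the ladder with an added square *)

Lemma verts_ladder n : verts (ladder n) = region n (columns (fun j => j < n.+1)%N).
Proof.
apply/setP => -[a b]; rewrite !inE /columns ltn_ord /=.
apply/orP/idP => [[]/imsetP[j _ [_ ->]]|b0]; rewrite ?inordK //.
have [b1|b2] : b = 1%N :> nat \/ b = 2 :> nat by have := ltn_ord b; lia.
  by left; apply/imsetP; exists a => //; congr (_, _); apply: val_inj; rewrite /= inordK.
by right; apply/imsetP; exists a => //; congr (_, _); apply: val_inj; rewrite /= inordK.
Qed.

Lemma verts_ladder_plus n k : (k < n)%N ->
  verts (ladder_plus n k.+1) =
  region n (fun a b => (0 < b) || (k <= a <= k.+1))%N.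
Proof.
move=> kn; rewrite -[LHS]/(verts (ladder n) :|: _) verts_ladder; apply/setP => -[a b].
rewrite !inE !xpair_eqE -!val_eqE /= /columns !inordK; have := ltn_ord a; lia.
Qed.

(** Every extra tile contains a vertex of the lowest row, so none fits in a region avoiding that
    row. *)
Lemma ladder_plus_sum_upper (A : comNzRingType) (x : A) n k
    (f : nat -> nat -> bool) : (k < n)%N -> (forall a, ~~ f a 0%N) ->
  region_sum x (ladder_plus n k.+1) f = region_sum x (ladder n) f.
Proof.
move=> kn f0; have low (B : {set grid n}) j :
    (j <= n)%N -> pt n j rowm1 \in B -> ~~ (B \subset region n f).
  move=> jn jB; apply/subsetPn; exists (pt n j rowm1) => //.
  by rewrite mem_region.
apply: eq_tiling_sum => B; rewrite inE => Bf.
  rewrite [in LHS]/ladder_plus /= in_setU [X in _ || X](_ : _ = false) ?orbF //.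
  apply/negbTE/negP; rewrite !inE => /orP[/orP[]|] /eqP E; move: Bf; apply/negP.
  - by apply: (low _ k); rewrite ?E ?inE ?eqxx ?orbT //; lia.
  - by apply: (low _ k); rewrite ?E ?inE ?eqxx ?orbT //; lia.
  - by apply: (low _ k.+1); rewrite ?E ?inE ?eqxx ?orbT //; lia.
rewrite [in LHS]/ladder_plus /= in_setU [X in _ || X](_ : _ = false) ?orbF //.
apply/negbTE/negP; rewrite !inE => /eqP E; move: Bf; apply/negP.
by apply: (low _ k); rewrite ?E ?inE ?eqxx ?orbT //; lia.
Qed.

(** The lower left vertex is covered by the left side, the bottom edge or the added square. The
    bottom edge leaves the whole ladder; the other two lead to the notch, with weights 1 and [x]. *)
Lemma ladder_plus_sum (A : comNzRingType) (x : A) n k : (k < n)%N ->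
  tiling_sum x (ladder_plus n k.+1) (verts (ladder_plus n k.+1)) =
  fib_poly (1 + x) n.+1 +
  (1 + x) * (fib_poly (1 + x) k * fib_poly (1 + x) (n - k.+1)).
Proof.
move=> kn; rewrite verts_ladder_plus // -/(region_sum _ _ _).
have kn' : (0 < k.+1 <= n)%N by lia.
rewrite (@region_sum_peel _ x _ _ _ (ladder_plus_rect_graph kn') _ k 0
  [:: (k, 0, 0, 1); (k, 1, 0, 0); (k, 1, 0, 1)]%N) //; try lia; first last.
- case=> [[[j w] y] h]; rewrite /ladder_plus_ok !inE !xpair_eqE /=; split.
    by move=> t; split=> [||a b]; lia.
  by case=> ok tc sub; lia.
- by rewrite /= !inE !xpair_eqE; lia.
rewrite !big_cons big_nil addr0 /= !mul1r.
(* After the left side, the lower right vertex can only be covered by the right side. *)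
rewrite (@region_sum_peel _ x _ _ _ (ladder_plus_rect_graph kn') _ k.+1 0
  [:: (k.+1, 0, 0, 1)]%N) //; try lia; first last.
- case=> [[[j w] y] h]; rewrite /ladder_plus_ok !inE !xpair_eqE /=; split.
    by move=> t; split=> [||a b]; lia.
  by case=> ok tc sub; have := sub k 0%N; lia.
rewrite big_seq1 /= !mul1r.
rewrite -ladder_sum_notch // -(ladder_sum_prefix x (leqnn n.+1)).
rewrite -!(ladder_plus_sum_upper x kn); try by move=> a; rewrite /columns; lia.
rewrite mulrDl mul1r addrCA; congr (_ + (_ + _ * _)); apply: eq_region_sum => a b an b2;
rewrite /columns; lia.
Qed.

(** * The polynomials of the theorem and their affine independence *)

Section LadderPolynomials.

Variable R : realType.
Local Notation p := (fib_poly ('X : {poly R})).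

(** The shift makes the weight [x = 'X - 1], so the parameter [1 + x] is ['X]. *)
Lemma P_ladderE n : P_ladder R n = p n.+1.
Proof.
rewrite /P_ladder P_polyE verts_ladder -/(region_sum _ _ _) ladder_sum_prefix //.
by rewrite (addrC 1) subrK.
Qed.

Lemma P_ladder_plusE n k : (k < n)%N ->
  P_ladder_plus R n k.+1 = p n.+1 + 'X * (p k * p (n - k.+1)).
Proof.
by move=> kn; rewrite /P_ladder_plus P_polyE ladder_plus_sum // (addrC 1) subrK.
Qed.

End LadderPolynomials.

(** Coefficients indexed by natural numbers, set to 0 out of range, survive rewriting of
    [size s]. *)
Lemma affinely_independent_nth (R : realType) (V : lmodType R) (s : seq V) :
    (forall c : nat -> R, \sum_(k < size s) c k = 0 ->
      \sum_(k < size s) c k *: s`_k = 0 -> forall k, (k < size s)%N -> c k = 0) ->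
  affinely_independent s.
Proof.
move=> H c c0 cs0 i; pose c' k := if insub k is Some j then c j else 0.
have c'E (j : 'I_(size s)) : c' j = c j by rewrite /c' valK.
rewrite -c'E; apply: H => //; first by rewrite -[RHS]c0; apply: eq_bigr.
by rewrite -[RHS]cs0; apply: eq_bigr => j _; rewrite c'E.
Qed.

(** Since the coefficients sum to zero, the base point [u] can be subtracted from every vector. *)
Lemma affine_relation_translate (R : nzRingType) (V : lmodType R) N
    (c : nat -> R) (u v : V) (g : nat -> V) :
    c 0%N + (c 1%N + \sum_(j < N) c j.+2) = 0 ->
    c 0%N *: u + (c 1%N *: (u + v) + \sum_(j < N) c j.+2 *: (u + g j)) = 0 ->
  c 1%N *: v + \sum_(j < N) c j.+2 *: g j = 0.
Proof.
move=> c0; under eq_bigr do rewrite scalerDr.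
by rewrite big_split -scaler_suml scalerDr addrACA !addrA -!scalerDl -!addrA c0
   scale0r add0r.
Qed.

Theorem theorem4p9 (R : realType) (d : nat) (hd : (0 < d)%N) :
  affinely_independent
    ([:: P_ladder R (2 * d - 1); P_ladder R (2 * d)]
       ++ [seq P_ladder_plus R (2 * d - 1) i | i <- iota 1 (d - 1)]).
Proof.
pose p := fib_poly ('X : {poly R}).
case: d hd => // N _.
have -> : (2 * N.+1 - 1 = N.*2.+1)%N by lia.
have -> : (2 * N.+1 = N.*2.+2)%N by lia.
have -> : (N.+1 - 1 = N)%N by lia.
apply: affinely_independent_nth => c /=; rewrite size_map size_iota.
rewrite !big_ord_recl => c0 cs0.
have nthE (k : 'I_N) : [seq P_ladder_plus R N.*2.+1 i | i <- iota 1 N]`_k =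
    p N.*2.+2 + 'X * (p k * p (N.*2 - k)%N).
  rewrite (nth_map 0%N) ?size_iota // nth_iota // add1n P_ladder_plusE.
    by rewrite subSS.
  by have := ltn_ord k; lia.
(* The base point is [p N.*2.+2], the first polynomial; one step of the recurrence writes the second
   as the base point plus ['X * p N.*2.+1]. *)
have {nthE} cs0' : c 0%N *: p N.*2.+2 + (c 1%N *: (p N.*2.+2 + 'X * p N.*2.+1) +
    \sum_(j < N) c j.+2 *: (p N.*2.+2 + 'X * (p j * p (N.*2 - j)%N))) = 0.
  rewrite -[RHS]cs0 /= !P_ladderE; congr (_ + (_ + _)).
  by apply: eq_bigr => j _; rewrite nthE.
have [] := @fib_poly_products_free R N (c 1%N) (fun j => c j.+2).
  (* All translated vectors are multiples of ['X], which is cancelled here. *)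
  apply: (mulfI (negbT (polyX_eq0 R))); rewrite mulr0 mulrDr mulr_sumr -scalerAr.
  rewrite -[RHS](@affine_relation_translate _ _ _ c _ _
    (fun j => 'X * (p j * p (N.*2 - j)%N)) c0 cs0'); congr (_ + _).
  by apply: eq_bigr => j _; rewrite -scalerAr.
move=> c1 cj [|[|k]] //; last exact: cj.
(* The coefficient of the base point vanishes last, through the zero sum of the coefficients. *)
by move=> _; move: c0; rewrite /= c1 big1 ?addr0 // => j _; apply: cj.
Qed.
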